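(* Suppose the stochastic basis $\psi_1,\dots,\psi_K$ satisfies property (P1): there is an orthogonal matrix $V\in\mathbb{R}^{K\times K}$, independent of $\hat v$, such that for every $\hat v\in\mathbb{R}^K$, $\mathcal{P}(\hat v)=V\Lambda_{\hat v}V^T$ with $\Lambda_{\hat v}$ diagonal. Consider the two-dimensional stochastic Galerkin shallow water system $\partial_t\hat u+\partial_x\hat F_1(\hat u)+\partial_y\hat F_2(\hat u)=\hat S$ for $\hat u=(\hat h,\hat q_1,\hat q_2)$ on the states with $\mathcal{P}(\hat h)$ positive definite, where, with $\hat v_d=\mathcal{P}^{-1}(\hat h)\hat q_d$ ($d=1,2$), $$\hat F_1=\begin{pmatrix}\hat q_1\\ \mathcal{P}(\hat q_1)\mathcal{P}^{-1}(\hat h)\hat q_1+\tfrac12g\,\mathcal{P}(\hat h)\hat h\\ \mathcal{P}(\hat q_2)\hat v_1\end{pmatrix},\quad \hat F_2=\begin{pmatrix}\hat q_2\\ \mathcal{P}(\hat q_1)\hat v_2\\ \mathcal{P}(\hat q_2)\mathcal{P}^{-1}(\hat h)\hat q_2+\tfrac12g\,\mathcal{P}(\hat h)\hat h\end{pmatrix},\quad \hat S=\begin{pmatrix}0\\ -g\,\mathcal{P}(\hat h)\partial_x\hat b\\ -g\,\mathcal{P}(\hat h)\partial_y\hat b\end{pmatrix}.$$ (a) The system is equipped with the entropy–entropy flux pair $$\hat\eta=\tfrac12\big(\hat q_1^T\mathcal{P}^{-1}(\hat h)\hat q_1+\hat q_2^T\mathcal{P}^{-1}(\hat h)\hat q_2+g\,\hat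 h^T\hat h\big)+g\,\hat h^T\hat b,$$ $$\hat H_d=\tfrac12\hat v_1^T\mathcal{P}(\hat q_d)\hat v_1+\tfrac12\hat v_2^T\mathcal{P}(\hat q_d)\hat v_2+g\,\hat q_d^T\hat h+g\,\hat q_d^T\hat b,\qquad d=1,2.$$ (b) The entropy variables $\hat w=(\partial\hat\eta/\partial\hat u)^T$ are $$\hat w=\Big(-\tfrac12\hat v_1^T\mathcal{P}(\hat v_1)-\tfrac12\hat v_2^T\mathcal{P}(\hat v_2)+g(\hat h+\hat b)^T,\ \hat v_1^T,\ \hat v_2^T\Big)^T,$$ and the entropy potential is $$\Phi=\hat w\cdot(\hat F_1+\hat F_2)-(\hat H_1+\hat H_2)=\tfrac12g\,\hat v_1^T\mathcal{P}(\hat h)\hat h+\tfrac12g\,\hat v_2^T\mathcal{P}(\hat h)\hat h .$$ (c) On a tensor-structured grid, an entropy conservative numerical flux is given by $$F_1^{\#}=\begin{pmatrix}\mathcal{P}(\overline{\hat h})\overline{\hat v_1}\\ \tfrac g2\overline{\mathcal{P}(\hat h)\hat h}+\mathcal{P}(\overline{\hat v_1})\mathcal{P}(\overline{\hat h})\overline{\hat v_1}\\ \mathcal{P}(\overline{\hat v_1})\mathcal{P}(\overline{\hat h})\overline{\hat v_2}\end{pmatrix},\qquad F_2^{\#}=\begin{pmatrix}\mathcal{P}(\overline{\hat h})\overline{\hat v_2}\\ \mathcal{P}(\overline{\hat v_2})\mathcal{P}(\overline{\hat h})\overline{\hat v_1}\\ \tfrac g2\overline{\mathcal{P}(\hat h)\hat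 h}+\mathcal{P}(\overline{\hat v_2})\mathcal{P}(\overline{\hat h})\overline{\hat v_2}\end{pmatrix},$$ where the averages are taken between the two states adjacent to an interface in the $x$-direction for $F_1^{\#}$ and in the $y$-direction for $F_2^{\#}$. Together with the source discretization in cell $(i,j)$ $$S_{i,j}^{\#}=\begin{pmatrix}0\\ -\frac{g}{2\Delta x}\Big(\mathcal{P}(\overline{\hat h}_{i+1/2,j})[\![\hat b]\!]_{i+1/2,j}+\mathcal{P}(\overline{\hat h}_{i-1/2,j})[\![\hat b]\!]_{i-1/2,j}\Big)\\ -\frac{g}{2\Delta y}\Big(\mathcal{P}(\overline{\hat h}_{i,j+1/2})[\![\hat b]\!]_{i,j+1/2}+\mathcal{P}(\overline{\hat h}_{i,j-1/2})[\![\hat b]\!]_{i,j-1/2}\Big)\end{pmatrix},$$ this flux results in a scheme that is well-balanced for lake at rest.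
   Context: Let $\rho$ be a probability density on $\mathbb{R}^n$, $\langle y,z\rangle=\int_{\mathbb{R}^n}y(s)z(s)\rho(s)\,ds$, and let $\psi_1,\dots,\psi_K$ be real functions, orthonormal with respect to $\langle\cdot,\cdot\rangle$, with finite triple products. The stochastic Galerkin matrix of $\hat v\in\mathbb{R}^K$ is the symmetric $K\times K$ matrix with entries $[\mathcal{P}(\hat v)]_{ij}=\sum_{k=1}^K\hat v_k\langle\psi_i\psi_j,\psi_k\rangle$; it satisfies $\mathcal{P}(\hat v)\hat w=\mathcal{P}(\hat w)\hat v$. $\mathcal{P}^{-1}(\hat v)$ denotes $(\mathcal{P}(\hat v))^{-1}$. The vectors $\hat h,\hat q_1,\hat q_2,\hat b\in\mathbb{R}^K$ contain the spectral coefficients of water height, of the discharges in the $x$- and $y$-directions, and of the time-independent bottom topography; $g>0$ is the gravitational constant. Entropy–entropy flux pair: $\hat\eta$ is a convex function of the conservative variables $\hat u$, and the compatibility conditions $\frac{\partial\hat\eta}{\partial\hat u}\frac{\partial\hat F_d}{\partial\hat u}=\frac{\partial\hat H_d}{\partial\hat u}$, $d=1,2$, hold (derivatives in $\hat u$ with $\hat b$ fixed). Averages and jumps: for adjacent states $a_-,a_+$ (with $a_+$ having the larger index), $\overline a=\tfrac12(a_-+a_+)$ and $[\![a]\!]=a_+-a_-$; subscripts $i\pm1/2,j$ (resp. $i,j\pm1/2$) denote the interface between cells $(i,j)$ and $(i\pm1,j)$ (resp. $(i,j\pm1)$). Entropy conservative numerical flux (in the sense of Tadmor, with bottom topography): with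 $\Phi_d=\hat w\cdot\hat F_d-\hat H_d$, for any two adjacent states (with their bottom values) one has $[\![\hat w]\!]\cdot F_d^{\#}=[\![\Phi_d]\!]+g\,F_{d,1}^{\#}\cdot[\![\hat b]\!]$ for $d=1,2$, where $F_{d,1}^{\#}\in\mathbb{R}^K$ is the first block component of $F_d^{\#}$. Scheme: the semi-discrete scheme on a uniform tensor grid with mesh sizes $\Delta x,\Delta y$, $$\frac{d}{dt}\hat u_{i,j}=-\frac{F^{\#}_{1,i+1/2,j}-F^{\#}_{1,i-1/2,j}}{\Delta x}-\frac{F^{\#}_{2,i,j+1/2}-F^{\#}_{2,i,j-1/2}}{\Delta y}+S^{\#}_{i,j}.$$ Well-balanced for lake at rest means: every discrete state with $\hat v_1=\hat v_2=0$ in all cells and $\hat h+\hat b$ equal to the same constant vector in all cells is a stationary solution of the scheme (the right-hand side vanishes). *)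

(* Defs.v *)
From HB Require Import structures.
From mathcomp Require Import all_boot all_order all_algebra.
From mathcomp Require Import all_classical all_reals all_analysis.

Set Implicit Arguments.
Unset Strict Implicit.
Unset Printing Implicit Defensive.

Import Order.TTheory GRing.Theory Num.Theory.
Import numFieldNormedType.Exports.

Local Open Scope classical_set_scope.
Local Open Scope ring_scope.

(* R^n is the measurable type [n.-tuple R]; its Lebesgue measure is built by
   induction on n, transporting the product measure along R x R^n -> R^n.+1. *)
Section TupleConsMeasure.
Variables (R : realType) (n : nat).
Variable m : {sigma_finite_measure set (n.-tuple R) -> \bar R}.

Definition tuple_cons (p : measurableTypeR R * n.-tuple R) : n.+1.-tuple R :=
  [tuple of p.1 :: p.2].

Lemma measurable_tuple_cons : measurable_fun setT tuple_cons.
Proof. exact: (@measurable_cons _ _ _ R fst n snd). Qed.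

Definition tuple_cons_measure : set (n.+1.-tuple R) -> \bar R :=
  pushforward (lebesgue_measure \x m)%E tuple_cons.

Let tcm0 : tuple_cons_measure set0 = 0%E.
Proof. by rewrite /tuple_cons_measure /pushforward preimage_set0 measure0. Qed.

Let tcm_ge0 A : (0 <= tuple_cons_measure A)%E.
Proof. by rewrite /tuple_cons_measure /pushforward. Qed.

Let mpre (A : set (n.+1.-tuple R)) :
  measurable A -> measurable (tuple_cons @^-1` A).
Proof.
move=> mA; rewrite -[X in measurable X]setTI.
exact: measurable_tuple_cons.
Qed.

Let tcm_sigma_additive : semi_sigma_additive tuple_cons_measure.
Proof.
move=> F mF tF mUF; rewrite /tuple_cons_measure /pushforward preimage_bigcup.
apply: measure_semi_sigma_additive.
- by move=> k; exact: mpre.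
- apply/trivIsetP => i j _ _ ij; rewrite -preimage_setI.
  by move/trivIsetP : tF => /(_ _ _ _ _ ij) ->//; rewrite preimage_set0.
- by rewrite -preimage_bigcup; exact: mpre.
Qed.

HB.instance Definition _ := isMeasure.Build _ _ _ tuple_cons_measure
  tcm0 tcm_ge0 tcm_sigma_additive.

Let tcm_sigma_finite : sigma_finite setT tuple_cons_measure.
Proof.
have /sigma_finiteP[F [FT ndF Foo]] := sigma_finiteT (@lebesgue_measure R).
have /sigma_finiteP[G [GT ndG Goo]] := sigma_finiteT m.
pose uncons (t : n.+1.-tuple R) : measurableTypeR R * n.-tuple R :=
  (thead t, [tuple of behead t]).
have unconsK : cancel tuple_cons uncons.
  by move=> [x t]; congr pair; apply: val_inj.
have muncons : measurable_fun setT uncons.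
  apply: measurable_fun_pair; first exact: measurable_tnth.
  exact: measurable_behead.
have FGT : \bigcup_k (F k `*` G k) = setT.
  apply/seteqP; split => // -[x y] _.
  have [i _ Fx] : (\bigcup_k F k) x by rewrite -FT.
  have [j _ Gy] : (\bigcup_k G k) y by rewrite -GT.
  exists (maxn i j) => //; split.
    by move: x Fx; exact/subsetPset/ndF/leq_maxl.
  by move: y Gy; exact/subsetPset/ndG/leq_maxr.
exists (fun k => uncons @^-1` (F k `*` G k)).
  by rewrite -preimage_bigcup FGT preimage_setT.
move=> k; have [mF Fk] := Foo k; have [mG Gk] := Goo k; split.
  by rewrite -[X in measurable X]setTI; apply: muncons => //; exact: measurableX.
rewrite /tuple_cons_measure /pushforward -comp_preimage.
rewrite (_ : uncons \o _ = id); last by apply/funext => x /=; rewrite unconsK.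
by rewrite preimage_id product_measure1E// lte_mul_pinfty// ge0_fin_numE.
Qed.

HB.instance Definition _ := Measure_isSigmaFinite.Build _ _ _
  tuple_cons_measure tcm_sigma_finite.

End TupleConsMeasure.

Fixpoint lebesgue_tuple (R : realType) (n : nat) :
    {sigma_finite_measure set (n.-tuple R) -> \bar R} :=
  if n is m.+1 then tuple_cons_measure (lebesgue_tuple R m)
  else \d_([tuple] : 0.-tuple R).

Lemma lebesgue_tuple_box (R : realType) (n : nat) (A : 'I_n -> set R) :
  (forall i, measurable (A i)) ->
  lebesgue_tuple R n [set t | forall i, A i (tnth t i)] =
  (\prod_(i < n) (@lebesgue_measure R (A i)))%E.
Proof.
elim: n A => [|n IH] A mA.
  rewrite big_ord0 /= diracE mem_set//; by case.
rewrite big_ord_recl /= -IH; last by move=> i.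
rewrite -product_measure1E; last 2 first.
- exact: (mA ord0).
- rewrite (_ : [set t | _] =
      \bigcap_(i in [set: 'I_n]) ((fun t : n.-tuple R => tnth t i) @^-1` (A (lift ord0 i)))).
    apply: fin_bigcap_measurable => // i _.
    by rewrite -[X in measurable X]setTI; exact: measurable_tnth.
  by apply/seteqP; split => [t At i _|t At i]; [exact: At|exact: At].
rewrite /tuple_cons_measure /pushforward; congr ((_ \x _)%E _).
apply/seteqP; split => [[x t] /= At|[x t] /= [Ax At] i].
  split=> [|i]; first by have := At ord0; rewrite tnth0.
  by have := At (lift ord0 i); rewrite tnthS.
case: (unliftP ord0 i) => [j|] ->; first by rewrite tnthS; exact: At.
by rewrite tnth0.
Qed.

Section StochasticBasis.
Variables (R : realType) (n K : nat).
Implicit Types (rho : n.-tuple R -> R) (psi : 'I_K -> n.-tuple R -> R).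

Definition probability_density rho : Prop :=
  [/\ measurable_fun setT rho,
      forall s, 0 <= rho s &
      (\int[lebesgue_tuple R n]_s (rho s)%:E)%E = 1%E].

(* The integrand of <y, z>. *)
Definition weighted rho (y z : n.-tuple R -> R) : n.-tuple R -> R :=
  fun s => y s * z s * rho s.

Definition inner rho (y z : n.-tuple R -> R) : R :=
  \int[lebesgue_tuple R n]_s weighted rho y z s.

(* [Rintegral] is total, so that the inner products exist has to be said. *)
Definition orthonormal_basis rho psi : Prop :=
  (forall i j, (lebesgue_tuple R n).-integrable setT
                 (EFin \o weighted rho (psi i) (psi j))) /\
  (forall i j, inner rho (psi i) (psi j) = (i == j)%:R).

Definition finite_triple_products rho psi : Prop :=
  forall i j k, (lebesgue_tuple R n).-integrable setT
                  (EFin \o weighted rho (psi i \* psi j) (psi k)).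

Definition galerkin_mx rho psi (v : 'cV[R]_K) : 'M[R]_K :=
  \matrix_(i, j) \sum_(k < K) v k 0 * inner rho (psi i \* psi j) (psi k).

Definition property_P1 (P : 'cV[R]_K -> 'M[R]_K) : Prop :=
  exists V : 'M[R]_K, V *m V^T = 1%:M /\
    forall v, exists d : 'rV[R]_K, P v = V *m diag_mx d *m V^T.

End StochasticBasis.

Section EntropyPairs.
Variables (R : realType) (N M : nat).

Definition dotv p (x y : 'cV[R]_p) : R := (x^T *m y) 0 0.

Definition posdef p (A : 'M[R]_p) : Prop :=
  A^T = A /\ forall x : 'cV[R]_p, x != 0 -> 0 < dotv x (A *m x).

(* Derivatives are rows, Jacobians have entries d F_i / d u_j. *)
Definition gradient (f : 'cV[R]_N -> R) (u : 'cV[R]_N) : 'rV[R]_N :=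
  \row_(j < N) 'D_(delta_mx j 0) f u.

Definition jacobian_mx (F : 'cV[R]_N -> 'cV[R]_N) (u : 'cV[R]_N) : 'M[R]_N :=
  \matrix_(i < N, j < N) ('D_(delta_mx j 0) F u) i 0.

(* Below [D] is the set of admissible states; entropies and entropy fluxes
   depend on a parameter in R^M (the bottom), written first and kept fixed in
   every derivative. *)
Implicit Types (D : set 'cV[R]_N) (F : 'cV[R]_N -> 'cV[R]_N).
Implicit Types (eta H : 'cV[R]_M -> 'cV[R]_N -> R).

Definition compatible D F eta H : Prop :=
  forall b u, D u ->
    [/\ differentiable (eta b) u, differentiable F u, differentiable (H b) u &
        gradient (eta b) u *m jacobian_mx F u = gradient (H b) u].

Definition entropy_pair D F1 F2 eta H1 H2 : Prop :=
  [/\ convex_set (M := 'cV[R]_N) D,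
      forall b, convex_function (E := 'cV[R]_N) D (eta b),
      compatible D F1 eta H1 &
      compatible D F2 eta H2].

Definition entropy_variables eta (b : 'cV[R]_M) (u : 'cV[R]_N) : 'cV[R]_N :=
  (gradient (eta b) u)^T.

Definition entropy_potential F eta H (b : 'cV[R]_M) (u : 'cV[R]_N) : R :=
  dotv (entropy_variables eta b u) (F u) - H b u.

(* [Fn um up] is the numerical flux between the left state [um] and the right
   state [up]; [fst_block] extracts its first block component. *)
Definition entropy_conservative (g : R) D F eta H
    (fst_block : 'cV[R]_N -> 'cV[R]_M)
    (Fn : 'cV[R]_N -> 'cV[R]_N -> 'cV[R]_N) : Prop :=
  forall (bm bp : 'cV[R]_M) (um up : 'cV[R]_N), D um -> D up ->
    dotv (entropy_variables eta bp up - entropy_variables eta bm um) (Fn um up)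
    = (entropy_potential F eta H bp up - entropy_potential F eta H bm um)
      + g * dotv (fst_block (Fn um up)) (bp - bm).

End EntropyPairs.

Section Scheme.
Variables (R : realType) (N M : nat) (dx dy : R).
Implicit Types (F1n F2n : 'cV[R]_N -> 'cV[R]_N -> 'cV[R]_N).

(* Grid functions: the cell (i, j) ranges over Z x Z. *)
Definition field p := int -> int -> 'cV[R]_p.

Definition scheme_rhs F1n F2n (S : field M -> field N -> field N)
    (b : field M) (u : field N) : field N := fun i j =>
  - (dx^-1 *: (F1n (u i j) (u (i + 1) j) - F1n (u (i - 1) j) (u i j)))
  - (dy^-1 *: (F2n (u i j) (u i (j + 1)) - F2n (u i (j - 1)) (u i j)))
  + S b u i j.

Definition scheme_solution (rhs : field N -> field N) (U : R -> field N) : Prop :=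
  forall (t : R) i j, is_derive t (1 : R) (fun s => U s i j) (rhs (U t) i j).

Definition stationary_solution (rhs : field N -> field N) (u : field N) : Prop :=
  scheme_solution rhs (fun=> u).

Lemma stationary_solutionP (rhs : field N -> field N) (u : field N) :
  stationary_solution rhs u <-> forall i j, rhs u i j = 0.
Proof.
split=> [su i j|u0 t i j]; last by rewrite u0; exact: is_derive_cst.
have [_ <-] := su 0 i j; exact: derive_cst.
Qed.

End Scheme.

Section ShallowWater.
Variables (R : realType) (K : nat) (g : R).
Variable P : 'cV[R]_K -> 'M[R]_K.

Local Notation vec := 'cV[R]_K.
Local Notation state := 'cV[R]_(K + (K + K)).
Implicit Types (u : state) (b : vec).

Definition mkstate (x y z : vec) : state := col_mx x (col_mx y z).

Definition height u : vec := usubmx u.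
Definition discharge1 u : vec := usubmx (dsubmx u).
Definition discharge2 u : vec := dsubmx (dsubmx u).

Definition velocity1 u : vec := invmx (P (height u)) *m discharge1 u.
Definition velocity2 u : vec := invmx (P (height u)) *m discharge2 u.

Definition admissible : set state := [set u | posdef (P (height u))].

Definition flux1 u : state :=
  let h := height u in let q1 := discharge1 u in let q2 := discharge2 u in
  mkstate q1
    (P q1 *m invmx (P h) *m q1 + (g / 2) *: (P h *m h))
    (P q2 *m velocity1 u).

Definition flux2 u : state :=
  let h := height u in let q1 := discharge1 u in let q2 := discharge2 u in
  mkstate q2
    (P q1 *m velocity2 u)
    (P q2 *m invmx (P h) *m q2 + (g / 2) *: (P h *m h)).

Definition entropy b u : R :=
  let h := height u in let q1 := discharge1 u in let q2 := discharge2 u in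
  2^-1 * (dotv q1 (invmx (P h) *m q1) + dotv q2 (invmx (P h) *m q2)
          + g * dotv h h)
  + g * dotv h b.

Definition entropy_flux (q : state -> vec) b u : R :=
  let v1 := velocity1 u in let v2 := velocity2 u in
  2^-1 * dotv v1 (P (q u) *m v1) + 2^-1 * dotv v2 (P (q u) *m v2)
  + g * dotv (q u) (height u) + g * dotv (q u) b.

Definition entropy_flux1 := entropy_flux discharge1.
Definition entropy_flux2 := entropy_flux discharge2.

Definition avg (x y : vec) : vec := 2^-1 *: (x + y).

Definition avg_of (f : state -> vec) um up : vec := avg (f um) (f up).

Definition pressure u : vec := P (height u) *m height u.

Definition num_flux1 um up : state :=
  let h := avg_of height um up in
  let v1 := avg_of velocity1 um up in let v2 := avg_of velocity2 um up in
  mkstate (P h *m v1)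
    ((g / 2) *: avg_of pressure um up + P v1 *m P h *m v1)
    (P v1 *m P h *m v2).

Definition num_flux2 um up : state :=
  let h := avg_of height um up in
  let v1 := avg_of velocity1 um up in let v2 := avg_of velocity2 um up in
  mkstate (P h *m v2)
    (P v2 *m P h *m v1)
    ((g / 2) *: avg_of pressure um up + P v2 *m P h *m v2).

Definition num_source (dx dy : R) (b : field R K) (u : field R (K + (K + K)))
    : field R (K + (K + K)) := fun i j =>
  mkstate 0
    (- (g / (2 * dx)) *:
       (P (avg_of height (u i j) (u (i + 1) j)) *m (b (i + 1) j - b i j)
        + P (avg_of height (u (i - 1) j) (u i j)) *m (b i j - b (i - 1) j)))
    (- (g / (2 * dy)) *:
       (P (avg_of height (u i j) (u i (j + 1))) *m (b i (j + 1) - b i j)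
        + P (avg_of height (u i (j - 1)) (u i j)) *m (b i j - b i (j - 1)))).

Definition lake_at_rest (b : field R K) (u : field R (K + (K + K))) : Prop :=
  (forall i j, velocity1 (u i j) = 0 /\ velocity2 (u i j) = 0) /\
  exists c : vec, forall i j, height (u i j) + b i j = c.

Definition well_balanced
    (rhs : field R K -> field R (K + (K + K)) -> field R (K + (K + K))) : Prop :=
  forall (b : field R K) (u : field R (K + (K + K))),
    (forall i j, admissible (u i j)) -> lake_at_rest b u ->
    stationary_solution (rhs b) u.

End ShallowWater.

(* Main.v *)
Require Import Defs.
From HB Require Import structures.
From mathcomp Require Import all_boot all_order all_algebra.
From mathcomp Require Import all_classical all_reals all_analysis.
From mathcomp Require Import ring.

Import Order.TTheory GRing.Theory Num.Theory.
Import numFieldNormedType.Exports.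

Set Implicit Arguments.
Unset Strict Implicit.
Unset Printing Implicit Defensive.

Local Open Scope classical_set_scope.
Local Open Scope ring_scope.

(** Write [x . y := P x *m y]; since triple products are symmetric in their
    three arguments, this product is commutative.  Under (P1) all the matrices
    [P x] commute, which makes it associative as well, and [P h] being positive
    definite for one [h] provides a unit [e = (P h)^-1 h].  Such an algebra,
    diagonalised by one orthogonal matrix, is the algebra of functions on [K]
    points: there are linear point values [pv i] with
    [pv i (P x *m y) = pv i x * pv i y], nonnegative weights [wt i] with
    [dotv x y = \sum_i wt i * (pv i x * pv i y)], and [P h] is positive definite
    exactly when all the [pv i h] are positive ([nodal_exists]).  This is a
    quadrature rule with [K] nodes that is exact on the stochastic basis.

    At every node the Galerkin system is then the deterministic shallow water
    system for the scalars [h, q1, q2] with bottom [b], and the entropy, the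
    entropy fluxes and all the inner products of the theorem are weighted sums
    over the nodes of their deterministic counterparts.  Convexity, the
    compatibility conditions, the entropy potential and the entropy
    conservation of the numerical fluxes become rational identities or
    inequalities between real numbers ([pt_entropy_convex], [pt_compatible],
    [pt_entropy_potential], [pt_entropy_conservative]).

    The [x]-flux, the [y]-flux and their sum are handled at once, as the fluxes
    [n1 F1 + n2 F2] in the directions [(1, 0)], [(0, 1)] and [(1, 1)]
    ([directional_fluxes]).  Differentiability needs an open set of states on
    which [invmx] is the true inverse: the states whose heights are nonzero at
    every node.

    For a lake at rest the velocities vanish and [b = c - h], so across every
    interface the jump of [b] is minus the jump of [h].  The source then cancels the
    pressure difference, because [P] of the average of [h], applied to the jump of
    [h], is half the jump of [P h *m h].

    When no state is admissible the claims are vacuous, so that a node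
    representation may be assumed. *)

(** * Differential calculus *)

(** The rules are stated pointwise, so that the derivative of a formula is obtained
    by composing them as terms that follow its syntax. *)
Section Differentials.
Variables (R : realType) (V : normedModType R).
Implicit Types (f g df dg : V -> R) (x : V).

(** Replaces a flux or an entropy by its nodal formula, which agrees with it only
    where [P h] is invertible. *)
Lemma near_eq_is_diff (W : normedModType R) (f g df : V -> W) x :
  (\near x, f x = g x) -> is_diff x f df -> is_diff x g df.
Proof.
move=> fg [dfx fdf].
have gE : g \o shift x = cst (g x) + 'd f x +o_ 0 id.
  apply/eqaddoP => /= e e0.
  have /eqaddoP/(_ e e0) fE := diff_locally dfx.
  have fg0 : \forall h \near 0, f (h + x) = g (h + x).
    by rewrite (near_shift x)/=; near=> y; rewrite /= sub0r subrK; near: y.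
  near=> h; rewrite /= !fctE/= -(nbhs_singleton fg) -(near fg0 h)//.
  by near: h.
have dgE := diff_unique (diff_continuous dfx) gE.
apply: DiffDef; last by rewrite dgE.
by apply/diff_locallyP; rewrite dgE; split=> //; exact: diff_continuous.
Unshelve. all: by end_near. Qed.

Lemma is_diff_add (W : normedModType R) (f g df dg : V -> W) x :
  is_diff x f df -> is_diff x g dg ->
  is_diff x (fun u => f u + g u) (fun k => df k + dg k).
Proof. exact: is_diffD. Qed.

Lemma is_diff_sum (W : normedModType R) n (f df : 'I_n -> V -> W) x :
  (forall i, is_diff x (f i) (df i)) ->
  is_diff x (fun u => \sum_i f i u) (fun k => \sum_i df i k).
Proof.
elim: n f df => [|n IH] f df fdf.
  rewrite (_ : (fun u => _) = cst 0); last by apply/funext=> u; rewrite big_ord0.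
  by apply: is_diff_eq; apply/funext=> u; rewrite big_ord0.
have recl (h : 'I_n.+1 -> V -> W) : (fun u => \sum_i h i u) =
    (fun u => h ord0 u + \sum_i h (lift ord0 i) u).
  by apply/funext => u; rewrite big_ord_recl.
rewrite !recl.
exact: (is_diff_add (fdf ord0) (IH _ _ (fun i => fdf (lift ord0 i)))).
Qed.

Lemma is_diff_mul f g df dg x :
  is_diff x f df -> is_diff x g dg ->
  is_diff x (fun u => f u * g u) (fun k => f x * dg k + g x * df k).
Proof. exact: is_diffM. Qed.

Lemma is_diff_const (c : R) x : is_diff x (fun=> c) (fun=> 0).
Proof. exact: is_diff_cst. Qed.

Lemma is_diff_mull c f df x :
  is_diff x f df -> is_diff x (fun u => c * f u) (fun k => c * df k).
Proof. exact: is_diffZ. Qed.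

Lemma is_diff_inv f df x : f x != 0 -> is_diff x f df ->
  is_diff x (fun u => (f u)^-1) (fun k => - (f x) ^- 2 * df k).
Proof.
move=> fx0 [dfx fdf]; apply: DiffDef; first exact: differentiableV.
by rewrite diffV// fdf.
Qed.

Lemma is_diff_scale (W : normedModType R) f df (w : W) x :
  is_diff x f df -> is_diff x (fun u => f u *: w) (fun k => df k *: w).
Proof.
move=> [dfx fdf]; apply: DiffDef; first exact: differentiableZl.
by rewrite diffZl// fdf.
Qed.

End Differentials.

(** A linear form on a finite-dimensional space is a combination of coordinates,
    hence its own differential. *)
Lemma is_diff_scalar_cV (R : realType) N (f : {scalar 'cV[R]_N}) (x : 'cV[R]_N) :
  is_diff x (f : 'cV[R]_N -> R) f.
Proof.
have fE : f = (fun y => \sum_i y i 0 *: f (delta_mx i 0)) :> ('cV[R]_N -> R).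
  apply/funext => y; rewrite {1}(matrix_sum_delta y) linear_sum.
  by apply: eq_bigr => i _; rewrite big_ord1 scalarZ.
rewrite fE; apply: is_diff_sum => i; apply: is_diff_scale.
have @l : {linear 'cV[R]_N -> R}.
  by exists (fun N : 'cV[R]_N => N i 0); do 2![eexists]; do ?[constructor];
     rewrite ?mxE// => ? *; rewrite ?mxE//; move=> ?; rewrite !mxE.
apply: DiffDef; first exact: differentiable_coord.
by rewrite (_ : (fun _ => _) = l) //; apply: diff_lin; exact/coord_continuous.
Qed.

(** * Inner products and blocks of a state *)

Lemma eq_mulmx_cV (R : comNzRingType) m p (A B : 'M[R]_(m, p)) :
  (forall z : 'cV[R]_p, A *m z = B *m z) -> A = B.
Proof.
move=> AB; apply/matrixP => i j.
have /matrixP/(_ i 0) := AB (delta_mx j 0).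
by rewrite -!colE !mxE.
Qed.

Section DotProduct.
Variable R : realType.

Lemma dotvE p (x y : 'cV[R]_p) : dotv x y = \sum_i x i 0 * y i 0.
Proof. by rewrite /dotv mxE; apply: eq_bigr => i _; rewrite mxE. Qed.

Lemma dotv_delta p (x : 'cV[R]_p) i : dotv x (delta_mx i 0) = x i 0.
Proof. by rewrite /dotv -colE !mxE. Qed.

Lemma dotv_is_scalar p (x : 'cV[R]_p) : scalar (dotv x).
Proof. by move=> a y z; rewrite /dotv mulmxDr -scalemxAr !mxE. Qed.

HB.instance Definition _ p (x : 'cV[R]_p) :=
  GRing.isLinear.Build R _ _ _ (dotv x) (dotv_is_scalar x).

Lemma dotv_mkstate K (a b c a' b' c' : 'cV[R]_K) :
  dotv (mkstate a b c) (mkstate a' b' c') = dotv a a' + (dotv b b' + dotv c c').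
Proof.
by rewrite /dotv /mkstate !tr_col_mx !mul_row_col mxE; congr (_ + _); rewrite mxE.
Qed.

Lemma mkstateK K (u : 'cV[R]_(K + (K + K))) :
  mkstate (height u) (discharge1 u) (discharge2 u) = u.
Proof. by rewrite /mkstate !vsubmxK. Qed.

Lemma height_mkstate K (a b c : 'cV[R]_K) : height (mkstate a b c) = a.
Proof. by rewrite /height col_mxKu. Qed.

Lemma discharge1_mkstate K (a b c : 'cV[R]_K) : discharge1 (mkstate a b c) = b.
Proof. by rewrite /discharge1 col_mxKd col_mxKu. Qed.

Lemma discharge2_mkstate K (a b c : 'cV[R]_K) : discharge2 (mkstate a b c) = c.
Proof. by rewrite /discharge2 !col_mxKd. Qed.
End DotProduct.

Section BlockLinear.
Variables (R : realType) (K : nat).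
Implicit Types u w : 'cV[R]_(K + (K + K)).

Lemma height_is_linear : linear (@height R K).
Proof. by move=> a u w; rewrite /height linearP. Qed.

Lemma discharge1_is_linear : linear (@discharge1 R K).
Proof. by move=> a u w; rewrite /discharge1 !linearP. Qed.

Lemma discharge2_is_linear : linear (@discharge2 R K).
Proof. by move=> a u w; rewrite /discharge2 !linearP. Qed.

HB.instance Definition _ :=
  GRing.isLinear.Build R _ _ _ (@height R K) height_is_linear.
HB.instance Definition _ :=
  GRing.isLinear.Build R _ _ _ (@discharge1 R K) discharge1_is_linear.
HB.instance Definition _ :=
  GRing.isLinear.Build R _ _ _ (@discharge2 R K) discharge2_is_linear.

(** The generic linearity rules unfold [height] and the discharges when they look
    for a linear map; rules keyed on these names keep rewriting cheap. *)
Lemma height_linE : ((forall u w, height (u + w) = height u + height w) *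
  (forall u, height (- u) = - height u) * (height (0 : 'cV[R]_(K + (K + K))) = 0) *
  (forall a u, height (a *: u) = a *: height u)).
Proof. by do !split => *; rewrite ?linearD ?linearN ?linear0 ?linearZ. Qed.

Lemma discharge1_linE :
  ((forall u w, discharge1 (u + w) = discharge1 u + discharge1 w) *
  (forall u, discharge1 (- u) = - discharge1 u) * (discharge1 (0 : 'cV[R]_(K + (K + K))) = 0) *
  (forall a u, discharge1 (a *: u) = a *: discharge1 u)).
Proof. by do !split => *; rewrite ?linearD ?linearN ?linear0 ?linearZ. Qed.

Lemma discharge2_linE :
  ((forall u w, discharge2 (u + w) = discharge2 u + discharge2 w) *
  (forall u, discharge2 (- u) = - discharge2 u) * (discharge2 (0 : 'cV[R]_(K + (K + K))) = 0) *
  (forall a u, discharge2 (a *: u) = a *: discharge2 u)).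
Proof. by do !split => *; rewrite ?linearD ?linearN ?linear0 ?linearZ. Qed.

Definition block_linE := (height_linE, discharge1_linE, discharge2_linE).

Definition block_mkstateE := (@height_mkstate R K, @discharge1_mkstate R K,
  @discharge2_mkstate R K).

End BlockLinear.

(** * Symmetries of the stochastic Galerkin matrix *)

Section GalerkinMatrix.
Variables (R : realType) (n K : nat).
Variables (rho : n.-tuple R -> R) (psi : 'I_K -> n.-tuple R -> R).
Let P := galerkin_mx rho psi.

(** The triple products are symmetric in their last two arguments. *)
Lemma galerkin_mxC (v w : 'cV[R]_K) : P v *m w = P w *m v.
Proof.
apply/matrixP => i o; rewrite ord1 !mxE.
under eq_bigr do rewrite mxE mulr_suml.
rewrite exchange_big/=; apply: eq_bigr => k _.
rewrite mxE mulr_suml; apply: eq_bigr => j _.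
have -> : inner rho (psi i \* psi j) (psi k) = inner rho (psi i \* psi k) (psi j).
  by congr Rintegral; apply/funext => s; rewrite /weighted/=; ring.
by ring.
Qed.

Lemma tr_galerkin_mx (v : 'cV[R]_K) : (P v)^T = P v.
Proof.
apply/matrixP => i j; rewrite !mxE; apply: eq_bigr => k _; congr (_ * _).
by congr Rintegral; apply/funext => s; rewrite /weighted/=; ring.
Qed.

Lemma galerkin_mx_linear : linear P.
Proof.
move=> a v w; apply/matrixP => i j; rewrite !mxE mulr_sumr -big_split/=.
by apply: eq_bigr => k _; rewrite !mxE mulrDl mulrA.
Qed.

End GalerkinMatrix.

(** * The nodes behind simultaneous diagonalisation *)

Section Nodes.
Variables (R : realType) (K : nat).

(** The algebra with product [P x *m y], presented as the functions on [K]
    points: [pv i] is evaluation at the node [i] and [wt i] its quadrature weight.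
    The family [bas] is the basis dual to [pv], which turns point values back into
    a vector. *)
Record nodal (P : 'cV[R]_K -> 'M[R]_K) (pv : 'I_K -> {scalar 'cV[R]_K})
    (wt : 'I_K -> R) (bas : 'I_K -> 'cV[R]_K) : Prop := Nodal {
  pvM : forall i x y, pv i (P x *m y) = pv i x * pv i y ;
  pv_expand : forall x, x = \sum_i pv i x *: bas i ;
  dotv_bas : forall i x, dotv x (bas i) = wt i * pv i x ;
  wt_ge0 : forall i, 0 <= wt i ;
  pv_unit : forall h, (forall i, pv i h != 0) -> P h \in unitmx ;
  pv_posdef : forall h, posdef (P h) <-> forall i, 0 < pv i h }.

Variable P : 'cV[R]_K -> 'M[R]_K.
Hypothesis P_linear : linear P.
Hypothesis PC : forall v w, P v *m w = P w *m v.

(** The point values of [x] are the eigenvalues of [P x] in the common eigenbasis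
    [V]: this is multiplicative because [P (P x *m y) = P x *m P y], a consequence
    of commutation.  The unit [e] recovers [x = P x *m e], so in the basis [V] the
    [i]-th coordinate of [x] is its point value times that of [e]; hence the
    weights are the squared coordinates of [e]. *)
Lemma nodal_exists (h0 : 'cV[R]_K) : property_P1 P -> posdef (P h0) ->
  exists pv wt bas, nodal P pv wt bas.
Proof.
move=> [V [VVT Pdiag]] pos0.
have VTV : V^T *m V = 1%:M by exact: mulmx1C.
pose pv i x := (V^T *m P x *m V) i i.
pose D x := diag_mx (\row_i pv i x).
have PE x : P x = V *m D x *m V^T.
  have [d Pd] := Pdiag x; rewrite Pd; congr (_ *m _ *m _).
  rewrite /D; congr diag_mx; apply/rowP => i; rewrite mxE /pv Pd.
  rewrite !mulmxA VTV mul1mx -mulmxA VTV mulmx1.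
  by rewrite mxE eqxx mulr1n.
have DE x : V^T *m P x *m V = D x.
  by rewrite PE !mulmxA VTV mul1mx -mulmxA VTV mulmx1.
have pvlin i : linear_for *%R (pv i).
  by move=> a x y; rewrite /pv P_linear mulmxDr mulmxDl -scalemxAr -scalemxAl !mxE.
have Pcomm x y : P x *m P y = P y *m P x.
  have E a b : P a *m P b = V *m (D a *m D b) *m V^T.
    rewrite (PE a) (PE b) !mulmxA; congr (_ *m _ *m _).
    by rewrite -(mulmxA (V *m D a)) VTV mulmx1.
  by rewrite !E /D !mulmx_diag; congr (_ *m diag_mx _ *m _);
    apply/rowP => i; rewrite !mxE mulrC.
have PM x y : P (P x *m y) = P x *m P y.
  apply: eq_mulmx_cV => z; rewrite (PC _ z) mulmxA Pcomm -!mulmxA.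
  by rewrite (PC z).
have pvM i x y : pv i (P x *m y) = pv i x * pv i y.
  rewrite {1}/pv PM.
  have -> : V^T *m (P x *m P y) *m V = D x *m D y.
    by rewrite -!DE !mulmxA -(mulmxA (_ *m P x) V) VVT mulmx1.
  by rewrite /D mulmx_diag !mxE eqxx mulr1n.
have unitP h : (forall i, pv i h != 0) -> P h \in unitmx.
  move=> h0'; rewrite PE !unitmx_mul.
  have [-> ->] := mulmx1_unit VVT; rewrite andbT/=.
  rewrite unitmxE det_diag unitfE; apply/prodf_neq0 => i _.
  by rewrite mxE.
have quadP h x : dotv x (P h *m x) = \sum_i pv i h * (V^T *m x) i 0 ^+ 2.
  rewrite PE /dotv -!mulmxA (mulmxA x^T).
  have -> : x^T *m V = (V^T *m x)^T by rewrite trmx_mul trmxK.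
  rewrite -/(dotv _ _) dotvE; apply: eq_bigr => i _.
  by rewrite mul_diag_mx !mxE; ring.
have posP h : posdef (P h) <-> forall i, 0 < pv i h.
  split=> [[_ pos] i|pos].
    have VTc : V^T *m col i V = delta_mx i 0.
      by rewrite colE mulmxA VTV mul1mx.
    have c0 : col i V != 0.
      apply/eqP => c0; move: VTc; rewrite c0 mulmx0 => /matrixP/(_ i 0).
      by rewrite !mxE !eqxx => /esym/eqP; rewrite oner_eq0.
    have := pos _ c0; rewrite quadP VTc (bigD1 i)//= big1 => [|j ji].
      by rewrite addr0 mxE !eqxx expr1n mulr1.
    by rewrite mxE (negbTE ji)/= expr0n/= mulr0.
  split=> [|x x0].
    by rewrite PE !trmx_mul trmxK tr_diag_mx mulmxA.
  rewrite quadP lt_neqAle eq_sym sumr_ge0 ?andbT; last first.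
    by move=> i _; rewrite mulr_ge0 ?sqr_ge0// ltW.
  apply: contra x0; rewrite psumr_eq0 => [/allP q0|i _]; last first.
    by rewrite mulr_ge0 ?sqr_ge0// ltW.
  have VTx : V^T *m x = 0.
    apply/matrixP => i j; rewrite ord1 [RHS]mxE; apply/eqP.
    have := q0 i (mem_index_enum i).
    by rewrite mulf_eq0 gt_eqF//= sqrf_eq0.
  by rewrite -(mul1mx x) -VVT -mulmxA VTx mulmx0.
have u0 : P h0 \in unitmx.
  by apply: unitP => i; rewrite gt_eqF//; apply: (posP h0).1.
(* the unit of the algebra: P h0 commutes with P x *)
have [e Pe] : exists e, forall x, P x *m e = x.
  exists (invmx (P h0) *m h0) => x.
  rewrite -(mulKmx u0 (P x *m _)) (mulmxA (P h0)) Pcomm -mulmxA.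
  by rewrite (mulKVmx u0) (PC x h0) (mulKmx u0).
(* mxE would otherwise unfold the point values *)
clearbody pv.
have [c VTE] : exists c, forall x i, (V^T *m x) i 0 = pv i x * c i.
  exists (fun i => (V^T *m e) i 0) => x i.
  by rewrite -{1}(Pe x) PE !mulmxA VTV mul1mx -mulmxA mul_diag_mx !mxE.
pose pvs i : {scalar 'cV[R]_K} :=
  HB.pack (pv i) (GRing.isLinear.Build _ _ _ _ (pv i) (pvlin i)).
exists pvs, (fun i => c i ^+ 2), (fun i => c i *: col i V); split => //=.
- move=> x; rewrite -{1}(mul1mx x) -VVT -mulmxA.
  apply/matrixP => i j; rewrite ord1 mxE summxE; apply: eq_bigr => k _.
  by rewrite VTE !mxE mulrC -mulrA.
- move=> i x; have -> : dotv x (c i *: col i V) = c i * (V^T *m x) i 0.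
    rewrite dotvE mxE mulr_sumr; apply: eq_bigr => j _.
    by rewrite !mxE mulrCA (mulrC (x j 0)).
  by rewrite VTE mulrCA mulrC expr2.
- by move=> i; exact: sqr_ge0.
Qed.
End Nodes.

(** * The deterministic system at one node *)

Section PointModel.
Variables (R : realType) (g : R).
Implicit Types b h q : R.

Definition pt_entropy (b h q1 q2 : R) : R :=
  2^-1 * (q1 * (q1 / h) + q2 * (q2 / h) + g * (h * h)) + g * (h * b).

(** The derivative of [pt_entropy] in [h]; those in [q1] and [q2] are the
    velocities [q1 / h] and [q2 / h]. *)
Definition pt_entropy_var0 (b h q1 q2 : R) : R :=
  - 2^-1 * ((q1 / h) * (q1 / h)) - 2^-1 * ((q2 / h) * (q2 / h)) + g * (h + b).

(** The flux across an interface with normal [(n1, n2)], of which the fluxes in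
    the two coordinate directions are special cases. *)
Variables n1 n2 : R.

Definition pt_flux0 (q1 q2 : R) : R := n1 * q1 + n2 * q2.

Definition pt_flux1 (h q1 q2 : R) : R :=
  q1 * (pt_flux0 q1 q2 / h) + n1 * (g / 2 * (h * h)).

Definition pt_flux2 (h q1 q2 : R) : R :=
  q2 * (pt_flux0 q1 q2 / h) + n2 * (g / 2 * (h * h)).

Definition pt_entropy_flux (b h q1 q2 : R) : R :=
  2^-1 * ((q1 / h) * (pt_flux0 q1 q2 * (q1 / h)))
  + 2^-1 * ((q2 / h) * (pt_flux0 q1 q2 * (q2 / h)))
  + g * (pt_flux0 q1 q2 * h) + g * (pt_flux0 q1 q2 * b).

Lemma pt_entropy_potential b h q1 q2 : h != 0 ->
  pt_entropy_var0 b h q1 q2 * pt_flux0 q1 q2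
  + (q1 / h * pt_flux1 h q1 q2 + q2 / h * pt_flux2 h q1 q2)
  - pt_entropy_flux b h q1 q2
  = 2^-1 * g * (pt_flux0 q1 q2 / h * (h * h)).
Proof.
by move=> h0; rewrite /pt_entropy_var0 /pt_flux1 /pt_flux2 /pt_entropy_flux /pt_flux0; field.
Qed.

Section PointDifferentials.
Variables (V : normedModType R) (h q1 q2 dh dq1 dq2 : V -> R) (x : V).
Hypotheses (h_diff : is_diff x h dh) (q1_diff : is_diff x q1 dq1)
  (q2_diff : is_diff x q2 dq2) (hx0 : h x != 0).

Let is_diff_quot (q dq : V -> R) : is_diff x q dq ->
  is_diff x (fun u => q u / h u) (fun k => (dq k - q x / h x * dh k) / h x).
Proof.
move=> q_diff; apply: is_diff_eq.
  by apply: (is_diff_mul q_diff); exact: is_diff_inv hx0 h_diff.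
by apply/funext => k; field.
Qed.

Lemma is_diff_pt_entropy b :
  is_diff x (fun u => pt_entropy b (h u) (q1 u) (q2 u))
    (fun k => pt_entropy_var0 b (h x) (q1 x) (q2 x) * dh k
              + (q1 x / h x * dq1 k + q2 x / h x * dq2 k)).
Proof.
have v1_diff := is_diff_quot q1_diff; have v2_diff := is_diff_quot q2_diff.
apply: is_diff_eq (is_diff_add
  (is_diff_mull 2^-1 (is_diff_add
    (is_diff_add (is_diff_mul q1_diff v1_diff) (is_diff_mul q2_diff v2_diff))
    (is_diff_mull g (is_diff_mul h_diff h_diff))))
  (is_diff_mull g (is_diff_mul h_diff (is_diff_const b x)))) _.
by apply/funext => k; rewrite /pt_entropy_var0 /=; field.
Qed.

(* derivative of the normal velocity *)
Let dvel k := (pt_flux0 (dq1 k) (dq2 k)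
               - pt_flux0 (q1 x) (q2 x) / h x * dh k) / h x.

Lemma is_diff_pt_flux0 :
  is_diff x (fun u => pt_flux0 (q1 u) (q2 u)) (fun k => pt_flux0 (dq1 k) (dq2 k)).
Proof. exact: is_diff_add (is_diff_mull n1 q1_diff) (is_diff_mull n2 q2_diff). Qed.

Let is_diff_pt_flux_component n (q dq : V -> R) : is_diff x q dq ->
  is_diff x (fun u => q u * (pt_flux0 (q1 u) (q2 u) / h u) + n * (g / 2 * (h u * h u)))
    (fun k => q x * dvel k + pt_flux0 (q1 x) (q2 x) / h x * dq k
              + n * (g / 2 * (h x * dh k + h x * dh k))).
Proof.
move=> q_diff.
exact: is_diff_add (is_diff_mul q_diff (is_diff_quot is_diff_pt_flux0))
  (is_diff_mull n (is_diff_mull (g / 2) (is_diff_mul h_diff h_diff))).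
Qed.

(** An identity between rational functions, stated along arbitrary differentiable
    states so that it applies to the point values of a Galerkin state. *)
Lemma pt_compatible b : exists d1 d2 : V -> R,
  [/\ is_diff x (fun u => pt_flux1 (h u) (q1 u) (q2 u)) d1,
      is_diff x (fun u => pt_flux2 (h u) (q1 u) (q2 u)) d2 &
      is_diff x (fun u => pt_entropy_flux b (h u) (q1 u) (q2 u))
        (fun k => pt_entropy_var0 b (h x) (q1 x) (q2 x)
                    * pt_flux0 (dq1 k) (dq2 k)
                  + (q1 x / h x * d1 k + q2 x / h x * d2 k))].
Proof.
exists (fun k => q1 x * dvel k + pt_flux0 (q1 x) (q2 x) / h x * dq1 k
              + n1 * (g / 2 * (h x * dh k + h x * dh k))).
exists (fun k => q2 x * dvel k + pt_flux0 (q1 x) (q2 x) / h x * dq2 k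
              + n2 * (g / 2 * (h x * dh k + h x * dh k))).
split; try exact: is_diff_pt_flux_component.
have v1_diff := is_diff_quot q1_diff; have v2_diff := is_diff_quot q2_diff.
have q_diff := is_diff_pt_flux0.
apply: is_diff_eq (is_diff_add (is_diff_add (is_diff_add
  (is_diff_mull 2^-1 (is_diff_mul v1_diff (is_diff_mul q_diff v1_diff)))
  (is_diff_mull 2^-1 (is_diff_mul v2_diff (is_diff_mul q_diff v2_diff))))
  (is_diff_mull g (is_diff_mul q_diff h_diff)))
  (is_diff_mull g (is_diff_mul q_diff (is_diff_const b x)))) _.
by apply/funext => k; rewrite /dvel /pt_entropy_var0 /pt_flux0 /=; field.
Qed.

End PointDifferentials.

(** Tadmor's condition at one node, written in the velocities [u] and [v].  It
    follows from the discrete Leibniz rule: the jump of a product is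
    the average of each factor times the jump of the other, so that the velocity
    terms of [w0] cancel against the convective terms, and the jump of
    [vn * h ^ 2] splits into the [g h] term of [w0] and the pressure terms. *)
Lemma pt_entropy_conservative bm bp hm hp um up vm vp :
  let vn a c := n1 * a + n2 * c in
  let hb := 2^-1 * (hm + hp) in
  let ub := 2^-1 * (um + up) in let vb := 2^-1 * (vm + vp) in
  let p := g / 2 * (2^-1 * (hm * hm + hp * hp)) in
  let F0 := hb * vn ub vb in
  let F1 := n1 * p + vn ub vb * (hb * ub) in
  let F2 := n2 * p + vn ub vb * (hb * vb) in
  let w0 b h u v := - 2^-1 * (u * u) - 2^-1 * (v * v) + g * (h + b) in
  (w0 bp hp up vp - w0 bm hm um vm) * F0 + ((up - um) * F1 + (vp - vm) * F2)
  = (2^-1 * g * (vn up vp * (hp * hp)) - 2^-1 * g * (vn um vm * (hm * hm)))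
    + g * (F0 * (bp - bm)).
Proof. by move=> /=; field. Qed.

End PointModel.

Section PointConvexity.
Variables (R : realType) (t s h h' : R).
Hypotheses (t_ge0 : 0 <= t) (s_ge0 : 0 <= s) (ts1 : t + s = 1).
Hypotheses (h_gt0 : 0 < h) (h'_gt0 : 0 < h').

Lemma pt_height_convex : 0 < t * h + s * h'.
Proof.
have [t0|t0] := eqVneq t 0.
  by move: ts1; rewrite t0 mul0r !add0r => ->; rewrite mul1r.
by rewrite ltr_wpDr ?mulr_ge0 ?(ltW h'_gt0)// mulr_gt0// lt_neqAle eq_sym t0.
Qed.

(** The quotient [q ^ 2 / h] is the perspective of the square: the convexity defect
    is a square divided by a product of positive heights. *)
Lemma pt_kinetic_convex (q q' : R) :
  (t * q + s * q') * ((t * q + s * q') / (t * h + s * h'))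
  <= t * (q * (q / h)) + s * (q' * (q' / h')).
Proof.
have H0 := pt_height_convex; rewrite -subr_ge0.
have -> : t * (q * (q / h)) + s * (q' * (q' / h'))
   - (t * q + s * q') * ((t * q + s * q') / (t * h + s * h'))
   = t * s * (q * h' - q' * h) ^+ 2 / (h * h' * (t * h + s * h')).
  have tE : t = 1 - s by rewrite -ts1 addrK.
  by move: H0; rewrite tE => H0; field; rewrite !gt_eqF.
apply: divr_ge0; last by rewrite ltW// !mulr_gt0.
by apply: mulr_ge0; [exact: mulr_ge0|exact: sqr_ge0].
Qed.

Lemma pt_entropy_convex (g b q1 q1' q2 q2' : R) : 0 <= g ->
  pt_entropy g b (t * h + s * h') (t * q1 + s * q1') (t * q2 + s * q2')
  <= t * pt_entropy g b h q1 q2 + s * pt_entropy g b h' q1' q2'.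
Proof.
move=> g0; rewrite -subr_ge0.
have K1 := pt_kinetic_convex q1 q1'; have K2 := pt_kinetic_convex q2 q2'.
rewrite -subr_ge0 in K1; rewrite -subr_ge0 in K2.
have K3 : 0 <= g * (t * s * (h - h') ^+ 2).
  by apply: mulr_ge0 => //; apply: mulr_ge0; [exact: mulr_ge0|exact: sqr_ge0].
have half_ge0 : 0 <= 2^-1 :> R by rewrite invr_ge0.
have K : 0 <= 2^-1 * (_ + _ + _) :=
  mulr_ge0 half_ge0 (addr_ge0 (addr_ge0 K1 K2) K3).
apply: le_trans K _.
rewrite le_eqVlt; apply/orP; left; apply/eqP; rewrite /pt_entropy.
have -> : t = 1 - s by rewrite -ts1 addrK.
by ring.
Qed.

End PointConvexity.

(** * Reading off gradients and Jacobians *)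

(** In terms of differentials, compatibility says that the differential of the
    entropy flux is that of the flux followed by that of the entropy; the matrix
    identity is its restriction to the basis vectors. *)
Lemma compatible_of_is_diff (R : realType) (N M : nat) (D : set 'cV[R]_N)
    (F : 'cV[R]_N -> 'cV[R]_N) (eta H : 'cV[R]_M -> 'cV[R]_N -> R) :
  (forall b u, D u -> exists w dF, [/\ is_diff u (eta b) (dotv w),
     is_diff u F dF & is_diff u (H b) (fun k => dotv w (dF k))]) ->
  compatible D F eta H.
Proof.
move=> diffs b u Du; have [w [dF [eta_diff F_diff H_diff]]] := diffs b u Du.
split=> //; apply/rowP => j; rewrite !mxE deriveE// diff_val dotvE.
apply: eq_bigr => i _; rewrite !mxE deriveE// diff_val deriveE// diff_val.
by rewrite dotv_delta.
Qed.

Lemma entropy_variables_of_is_diff (R : realType) (N M : nat)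
    (eta : 'cV[R]_M -> 'cV[R]_N -> R) b (u w : 'cV[R]_N) :
  is_diff u (eta b) (dotv w) -> entropy_variables eta b u = w.
Proof.
move=> eta_diff; apply/colP => j.
by rewrite !mxE deriveE// diff_val dotv_delta.
Qed.

(** * From the nodes to the stochastic Galerkin system *)

Section Global.
Variables (R : realType) (K : nat) (g : R).
Variable P : 'cV[R]_K -> 'M[R]_K.
Variables (pv : 'I_K -> {scalar 'cV[R]_K}) (wt : 'I_K -> R).
Variable bas : 'I_K -> 'cV[R]_K.
Hypothesis N : nodal P pv wt bas.

Local Notation state := 'cV[R]_(K + (K + K)).
Implicit Types (u w : state) (i : 'I_K) (b x y : 'cV[R]_K).

Lemma pv_linE : ((forall i x y, pv i (x + y) = pv i x + pv i y) *
  (forall i x, pv i (- x) = - pv i x) * (forall i, pv i 0 = 0) *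
  (forall i a x, pv i (a *: x) = a * pv i x)).
Proof.
by do !split => *; rewrite ?linearD ?linearN ?linear0 ?scalarZ.
Qed.

Lemma dotv_pv x y : dotv x y = \sum_i wt i * (pv i x * pv i y).
Proof.
rewrite {1}(pv_expand N y) /dotv mulmx_sumr summxE; apply: eq_bigr => i _.
rewrite -scalemxAr mxE -/(dotv x (bas i)) (dotv_bas N); ring.
Qed.

Lemma eq_pv x y : (forall i, pv i x = pv i y) -> x = y.
Proof.
move=> xy; rewrite (pv_expand N x) (pv_expand N y).
by apply: eq_bigr => i _; rewrite xy.
Qed.

Lemma eq_pv_state u w : (forall i, pv i (height u) = pv i (height w)) ->
  (forall i, pv i (discharge1 u) = pv i (discharge1 w)) ->
  (forall i, pv i (discharge2 u) = pv i (discharge2 w)) -> u = w.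
Proof.
move=> /eq_pv e0 /eq_pv e1 /eq_pv e2.
by rewrite -(mkstateK u) -(mkstateK w) e0 e1 e2.
Qed.

(** An open set of states, containing the admissible ones, on which [P h] is
    invertible and all formulas hold node by node. *)
Definition wet u : Prop := forall i, pv i (height u) != 0.

Lemma admissible_wet u : admissible P u -> wet u.
Proof. by move=> /(pv_posdef N) pos i; rewrite gt_eqF. Qed.

Lemma pv_solve x y i : (forall j, pv j x != 0) ->
  pv i (invmx (P x) *m y) = pv i y / pv i x.
Proof.
move=> x0; have Px := pv_unit N x0.
apply: (mulfI (x0 i)); rewrite -(pvM N) mulKVmx//.
by rewrite mulrC divfK.
Qed.

Lemma is_diff_height i u :
  is_diff u (fun w => pv i (height w)) (fun k => pv i (height k)).
Proof. exact: (is_diff_scalar_cV (pv i \o @height R K) u). Qed.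

Lemma is_diff_discharge1 i u :
  is_diff u (fun w => pv i (discharge1 w)) (fun k => pv i (discharge1 k)).
Proof. exact: (is_diff_scalar_cV (pv i \o @discharge1 R K) u). Qed.

Lemma is_diff_discharge2 i u :
  is_diff u (fun w => pv i (discharge2 w)) (fun k => pv i (discharge2 k)).
Proof. exact: (is_diff_scalar_cV (pv i \o @discharge2 R K) u). Qed.

Lemma near_wet u : wet u -> \near u, wet u.
Proof.
move=> u0; apply: (@filter_forall _ _ (fun i w => pv i (height w) != 0) (nbhs u)) => i.
have [/differentiable_continuous c _] := is_diff_height i u.
exact: (cvgr_neq0 _ c (u0 i)).
Qed.

Local Notation at_node f i u :=
  (f (pv i (height u)) (pv i (discharge1 u)) (pv i (discharge2 u))).

Lemma entropy_nodal b u : wet u ->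
  entropy g P b u = \sum_i wt i * at_node (pt_entropy g (pv i b)) i u.
Proof.
move=> u0; rewrite /entropy !dotv_pv !mulr_sumr -!big_split mulr_sumr -big_split.
by apply: eq_bigr => i _; rewrite /pt_entropy !pv_solve//=; ring.
Qed.

Definition entropy_gradient b u : state :=
  mkstate (- 2^-1 *: (P (velocity1 P u) *m velocity1 P u)
           - 2^-1 *: (P (velocity2 P u) *m velocity2 P u)
           + g *: (height u + b))
    (velocity1 P u) (velocity2 P u).

Lemma dotv_state u w : dotv u w = \sum_i wt i *
  (pv i (height u) * pv i (height w)
   + (pv i (discharge1 u) * pv i (discharge1 w)
      + pv i (discharge2 u) * pv i (discharge2 w))).
Proof.
rewrite -{1}(mkstateK u) -{1}(mkstateK w) dotv_mkstate !dotv_pv -!big_split.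
by apply: eq_bigr => i _ /=; rewrite !mulrDr.
Qed.

Lemma pv_entropy_gradient b u i : wet u ->
  pv i (height (entropy_gradient b u)) = at_node (pt_entropy_var0 g (pv i b)) i u.
Proof.
by move=> u0; rewrite height_mkstate !pv_linE !(pvM N) !pv_solve.
Qed.

Lemma dotv_entropy_gradient b u w : wet u -> dotv (entropy_gradient b u) w =
  \sum_i wt i * (at_node (pt_entropy_var0 g (pv i b)) i u * pv i (height w)
    + (pv i (discharge1 u) / pv i (height u) * pv i (discharge1 w)
       + pv i (discharge2 u) / pv i (height u) * pv i (discharge2 w))).
Proof.
move=> u0; rewrite dotv_state; apply: eq_bigr => i _.
by rewrite pv_entropy_gradient// discharge1_mkstate discharge2_mkstate !pv_solve.
Qed.

Lemma is_diff_entropy b u : wet u ->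
  is_diff u (entropy g P b) (dotv (entropy_gradient b u)).
Proof.
move=> u0.
apply: (near_eq_is_diff (f := fun w =>
    \sum_i wt i * at_node (pt_entropy g (pv i b)) i w)).
  by near=> w; rewrite entropy_nodal//; near: w; exact: near_wet.
apply: is_diff_eq.
  apply: is_diff_sum => i; apply: is_diff_mull.
  exact: (is_diff_pt_entropy g (is_diff_height i u) (is_diff_discharge1 i u)
    (is_diff_discharge2 i u) (u0 i) (pv i b)).
by apply/funext => k; rewrite dotv_entropy_gradient.
Unshelve. all: by end_near. Qed.

Section Direction.
Variables (n1 n2 : R) (F : state -> state) (H : 'cV[R]_K -> state -> R).

(** [F] and [H] are at every node the flux and the entropy flux of the
    deterministic system in the direction [(n1, n2)]. *)
Definition directional_fluxes : Prop := forall u, wet u ->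
  (forall i,
    [/\ pv i (height (F u))
          = pt_flux0 n1 n2 (pv i (discharge1 u)) (pv i (discharge2 u)),
        pv i (discharge1 (F u)) = at_node (pt_flux1 g n1 n2) i u &
        pv i (discharge2 (F u)) = at_node (pt_flux2 g n1 n2) i u]) /\
  (forall b, H b u
     = \sum_i wt i * at_node (pt_entropy_flux g n1 n2 (pv i b)) i u).

Hypothesis FH : directional_fluxes.

Lemma directional_flux_expand u : wet u ->
  F u = \sum_i (pt_flux0 n1 n2 (pv i (discharge1 u)) (pv i (discharge2 u))
                  *: mkstate (bas i) 0 0
                + at_node (pt_flux1 g n1 n2) i u *: mkstate 0 (bas i) 0
                + at_node (pt_flux2 g n1 n2) i u *: mkstate 0 0 (bas i)).
Proof.
move=> u0; have [Fu _] := FH u0.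
rewrite -[LHS]mkstateK -[RHS]mkstateK.
rewrite [in LHS](pv_expand N (height (F u))).
rewrite [in LHS](pv_expand N (discharge1 (F u))).
rewrite [in LHS](pv_expand N (discharge2 (F u))).
congr mkstate; rewrite linear_sum; apply: eq_bigr => i _ /=; have [E0 E1 E2] := Fu i.
- by rewrite E0 !block_linE !block_mkstateE !scaler0 !addr0.
- by rewrite E1 !block_linE !block_mkstateE !scaler0 addr0 add0r.
- by rewrite E2 !block_linE !block_mkstateE !scaler0 !add0r.
Qed.

(** The fluxes are differentiated node by node in the expansion
    [directional_flux_expand]; pairing the result with the entropy variables
    picks the weight of each node, which gives the differential of [H]. *)
Lemma is_diff_flux b u : wet u -> exists dF, is_diff u F dF /\
  is_diff u (H b) (fun k => dotv (entropy_gradient b u) (dF k)).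
Proof.
move=> u0.
have /choice[d dP] i := pt_compatible g n1 n2 (is_diff_height i u)
  (is_diff_discharge1 i u) (is_diff_discharge2 i u) (u0 i) (pv i b).
have {dP} /choice[d' dP] := dP.
pose dF k : state :=
  \sum_i (pt_flux0 n1 n2 (pv i (discharge1 k)) (pv i (discharge2 k))
                  *: mkstate (bas i) 0 0
                + d i k *: mkstate 0 (bas i) 0
                + d' i k *: mkstate 0 0 (bas i)).
exists dF; split.
  apply: (near_eq_is_diff (f := fun u => \sum_i
      (pt_flux0 n1 n2 (pv i (discharge1 u)) (pv i (discharge2 u))
                  *: mkstate (bas i) 0 0
                + at_node (pt_flux1 g n1 n2) i u *: mkstate 0 (bas i) 0
                + at_node (pt_flux2 g n1 n2) i u *: mkstate 0 0 (bas i)))).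
    by near=> w; rewrite directional_flux_expand//; near: w; exact: near_wet.
  apply: is_diff_sum => i; have [d1 d2 _] := dP i.
  have d0 := is_diff_pt_flux0 n1 n2 (is_diff_discharge1 i u) (is_diff_discharge2 i u).
  exact: is_diff_add (is_diff_add (is_diff_scale _ d0) (is_diff_scale _ d1))
    (is_diff_scale _ d2).
apply: (near_eq_is_diff (f := fun w => \sum_i wt i *
    at_node (pt_entropy_flux g n1 n2 (pv i b)) i w)).
  near=> w; have [|_ ->//] := FH (u := w).
  by near: w; exact: near_wet.
have H_diff i := let: And3 _ _ H_diff := dP i in H_diff.
apply: is_diff_eq (is_diff_sum (fun i => is_diff_mull (wt i) (H_diff i))) _.
apply/funext => k.
rewrite linear_sum; apply: eq_bigr => i _.
rewrite !linearD !scalarZ /= -[entropy_gradient b u]mkstateK !dotv_mkstate.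
rewrite !(dotv_bas N) !linear0 !addr0 !add0r pv_entropy_gradient//.
rewrite discharge1_mkstate discharge2_mkstate !pv_solve//.
by ring.
Unshelve. all: by end_near. Qed.

Lemma directional_compatible :
  compatible (admissible P) F (entropy g P) H.
Proof.
apply: compatible_of_is_diff => b u /admissible_wet u0.
have [dF [F_diff H_diff]] := is_diff_flux b u0.
by exists (entropy_gradient b u), dF; split=> //; exact: is_diff_entropy.
Qed.

Lemma directional_potential b u : wet u ->
  entropy_potential F (entropy g P) H b u
  = \sum_i wt i * (2^-1 * g *
      (pt_flux0 n1 n2 (pv i (discharge1 u)) (pv i (discharge2 u)) / pv i (height u)
       * (pv i (height u) * pv i (height u)))).
Proof.
move=> u0; have [Fu Hu] := FH u0.
rewrite /entropy_potential (entropy_variables_of_is_diff (is_diff_entropy b u0)).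
rewrite dotv_entropy_gradient// Hu -sumrB; apply: eq_bigr => i _.
have [-> -> ->] := Fu i.
by rewrite -mulrBr pt_entropy_potential.
Qed.

Lemma directional_conservative (Fn : state -> state -> state) :
  (forall um up i, wet um -> wet up ->
    let a f := 2^-1 * (f um + f up) in
    let h w := pv i (height w) in
    let v1 w := pv i (discharge1 w) / h w in
    let v2 w := pv i (discharge2 w) / h w in
    let vn := n1 * a v1 + n2 * a v2 in
    let p := g / 2 * (a (fun w => h w * h w)) in
    [/\ pv i (height (Fn um up)) = a h * vn,
        pv i (discharge1 (Fn um up)) = n1 * p + vn * (a h * a v1) &
        pv i (discharge2 (Fn um up)) = n2 * p + vn * (a h * a v2)]) ->
  entropy_conservative g (admissible P) F (entropy g P) H (@height R K) Fn.
Proof.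
move=> FnE bm bp um up /admissible_wet um0 /admissible_wet up0.
rewrite !(entropy_variables_of_is_diff (is_diff_entropy _ _))//.
rewrite !directional_potential// dotv_state dotv_pv mulr_sumr -sumrB -big_split.
apply: eq_bigr => i _ /=; have [-> -> ->] := FnE um up i um0 up0.
rewrite !block_linE !pv_linE !pv_entropy_gradient// !block_mkstateE !pv_solve//.
rewrite [g * (wt i * _)]mulrCA -mulrBr -mulrDr; congr (_ * _).
rewrite (pt_entropy_conservative g n1 n2 (pv i bm) (pv i bp)).
rewrite /pt_flux0; field.
by rewrite um0 up0.
Qed.

End Direction.

Lemma directional_flux1 :
  directional_fluxes 1 0 (flux1 g P) (entropy_flux1 g P).
Proof.
move=> u u0; split=> [i|b].
  rewrite /flux1 !block_mkstateE -mulmxA !pv_linE !(pvM N) !pv_solve//.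
  rewrite /pt_flux1 /pt_flux2 /pt_flux0.
  by split; ring.
rewrite /entropy_flux1 /entropy_flux !dotv_pv !mulr_sumr -!big_split.
apply: eq_bigr => i _ /=; rewrite !(pvM N) !pv_solve// /pt_entropy_flux /pt_flux0.
by ring.
Qed.

Lemma directional_flux2 :
  directional_fluxes 0 1 (flux2 g P) (entropy_flux2 g P).
Proof.
move=> u u0; split=> [i|b].
  rewrite /flux2 !block_mkstateE -mulmxA !pv_linE !(pvM N) !pv_solve//.
  rewrite /pt_flux1 /pt_flux2 /pt_flux0.
  by split; ring.
rewrite /entropy_flux2 /entropy_flux !dotv_pv !mulr_sumr -!big_split.
apply: eq_bigr => i _ /=; rewrite !(pvM N) !pv_solve// /pt_entropy_flux /pt_flux0.
by ring.
Qed.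

Lemma directional_flux_sum :
  directional_fluxes 1 1 (fun u => flux1 g P u + flux2 g P u)
    (fun b u => entropy_flux1 g P b u + entropy_flux2 g P b u).
Proof.
move=> u u0; have [F1 H1] := directional_flux1 u0.
have [F2 H2] := directional_flux2 u0; split=> [i|b].
  have [E0 E1 E2] := F1 i; have [E0' E1' E2'] := F2 i.
  rewrite !block_linE !pv_linE E0 E1 E2 E0' E1' E2' /pt_flux1 /pt_flux2 /pt_flux0.
  by split; ring.
rewrite H1 H2 -big_split; apply: eq_bigr => i _ /=.
by rewrite /pt_entropy_flux /pt_flux0; ring.
Qed.

Lemma num_flux1_conservative :
  entropy_conservative g (admissible P) (flux1 g P) (entropy g P)
    (entropy_flux1 g P) (@height R K) (num_flux1 g P).
Proof.
apply: (directional_conservative directional_flux1) => um up i um0 up0.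
rewrite /num_flux1 !block_mkstateE /avg_of /avg /pressure.
rewrite -!mulmxA ?(pv_linE, pvM N) !pv_solve//.
by split; ring.
Qed.

Lemma num_flux2_conservative :
  entropy_conservative g (admissible P) (flux2 g P) (entropy g P)
    (entropy_flux2 g P) (@height R K) (num_flux2 g P).
Proof.
apply: (directional_conservative directional_flux2) => um up i um0 up0.
rewrite /num_flux2 !block_mkstateE /avg_of /avg /pressure.
rewrite -!mulmxA ?(pv_linE, pvM N) !pv_solve//.
by split; ring.
Qed.

Lemma admissible_convex : convex_set (M := state) (admissible P).
Proof.
move=> x y t /set_mem /(pv_posdef N) x0 /set_mem /(pv_posdef N) y0.
apply/mem_set/(pv_posdef N) => i.
rewrite /conv/= !block_linE !pv_linE.
by apply: pt_height_convex => //; [exact: unstable.onem_ge0|exact: unstable.add_onemK].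
Qed.

Lemma entropy_convex b : 0 <= g ->
  convex_function (E := state) (admissible P) (entropy g P b).
Proof.
move=> g0 t x y xD yD.
have /set_mem/admissible_wet c0 := admissible_convex t xD yD.
move: xD yD => /set_mem xD /set_mem yD.
have /(pv_posdef N) x0 := xD; have /(pv_posdef N) y0 := yD.
rewrite convRE !entropy_nodal//; try exact: admissible_wet.
rewrite !mulr_sumr -big_split; apply: ler_sum => i _ /=.
rewrite [leRHS](_ : _ = wt i * (t%:num * at_node (pt_entropy g (pv i b)) i x
  + unstable.onem t%:num * at_node (pt_entropy g (pv i b)) i y)); last by ring.
apply: ler_wpM2l (wt_ge0 N i) _ _ _; rewrite /conv/= !block_linE !pv_linE.
by apply: pt_entropy_convex => //; [exact: unstable.onem_ge0|exact: unstable.add_onemK].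
Qed.

(** With zero velocities only the pressure and the source survive; after replacing
    [b] by [c - h] they cancel at each node, the average of [h] times its jump
    being half the jump of [h ^ 2]. *)
Lemma scheme_well_balanced (dx dy : R) : 0 < dx -> 0 < dy ->
  well_balanced P (scheme_rhs dx dy (num_flux1 g P) (num_flux2 g P)
    (num_source g P dx dy)).
Proof.
move=> dx0 dy0 b u uD [v0 [c hb]]; apply/stationary_solutionP => i j.
have bE k l : b k l = c - height (u k l) by rewrite -(hb k l) addrC addKr.
have V1 k l : velocity1 P (u k l) = 0 by have [] := v0 k l.
have V2 k l : velocity2 P (u k l) = 0 by have [] := v0 k l.
rewrite /scheme_rhs /num_source /num_flux1 /num_flux2 /avg_of /avg !bE !V1 !V2.
rewrite addr0 scaler0 !mulmx0 !addr0 /pressure.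
apply: eq_pv_state => k; rewrite !block_linE ?block_mkstateE.
- by rewrite !pv_linE; ring.
- by rewrite ?(pv_linE, pvM N); field; rewrite !gt_eqF.
- by rewrite ?(pv_linE, pvM N); field; rewrite !gt_eqF.
Qed.

End Global.

(** * The entropy structure and the well-balanced scheme *)

Theorem theorem4p3 (R : realType) (n K : nat)
    (rho : n.-tuple R -> R) (psi : 'I_K -> n.-tuple R -> R) (g : R)
    (rho_density : probability_density rho)
    (psi_orthonormal : orthonormal_basis rho psi)
    (psi_triple : finite_triple_products rho psi)
    (g_gt0 : 0 < g)
    (P1 : property_P1 (galerkin_mx rho psi)) :
  let P := galerkin_mx rho psi in
  let F1 := flux1 g P in
  let F2 := flux2 g P in
  let eta := entropy g P in
  let H1 := entropy_flux1 g P in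
  let H2 := entropy_flux2 g P in
  entropy_pair (admissible P) F1 F2 eta H1 H2 /\
  (forall (b : 'cV[R]_K) (u : 'cV[R]_(K + (K + K))), admissible P u ->
     let h := height u in
     let v1 := velocity1 P u in
     let v2 := velocity2 P u in
     entropy_variables eta b u
       = mkstate
           ((- 2^-1 *: (v1^T *m P v1) - 2^-1 *: (v2^T *m P v2)
             + g *: (h + b)^T)^T)
           v1 v2 /\
     entropy_potential (fun u => F1 u + F2 u) eta
       (fun b u => H1 b u + H2 b u) b u
       = 2^-1 * g * dotv v1 (P h *m h) + 2^-1 * g * dotv v2 (P h *m h)) /\
  entropy_conservative g (admissible P) F1 eta H1 (@height R K)
    (num_flux1 g P) /\
  entropy_conservative g (admissible P) F2 eta H2 (@height R K)
    (num_flux2 g P) /\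
  (forall dx dy : R, 0 < dx -> 0 < dy ->
     well_balanced P
       (scheme_rhs dx dy (num_flux1 g P) (num_flux2 g P)
          (num_source g P dx dy))).
Proof.
set P := galerkin_mx rho psi => F1 F2 eta H1 H2.
(* without admissible states there is nothing to prove *)
have [[u0 u0D]|noD] := pselect (exists u, admissible P u); last first.
  have absurd u : ~ admissible P u by move=> uD; apply: noD; exists u.
  split; [split|split; [|split; [|split]]].
  - by move=> x y t /set_mem/absurd.
  - by move=> b t x y /set_mem/absurd.
  - by move=> b u /absurd.
  - by move=> b u /absurd.
  - by move=> b u /absurd.
  - by move=> bm bp um up /absurd.
  - by move=> bm bp um up /absurd.
  - by move=> dx dy _ _ b u /(_ 0 0)/absurd.
have [pv [wt [bas N]]] := nodal_exists (@galerkin_mx_linear _ _ _ rho psi)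
  (@galerkin_mxC _ _ _ rho psi) P1 u0D.
split; [split|split; [|split; [|split]]].
- exact: (admissible_convex N).
- by move=> b; apply: (entropy_convex N); exact: ltW.
- exact: (directional_compatible N (directional_flux1 g N)).
- exact: (directional_compatible N (directional_flux2 g N)).
- move=> b u uD h v1 v2; have uwet := admissible_wet N uD; split.
    rewrite (entropy_variables_of_is_diff (is_diff_entropy g N b uwet)).
    congr mkstate.
    by rewrite !linearD/= !linearN/= !linearZ/= trmxK !trmx_mul !trmxK !tr_galerkin_mx.
  rewrite (directional_potential N (directional_flux_sum g N) b uwet).
  rewrite !(dotv_pv N) !mulr_sumr -big_split; apply: eq_bigr => i _ /=.
  by rewrite !(pvM N) !(pv_solve N)// /pt_flux0; ring.
- exact: (num_flux1_conservative g N).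
- exact: (num_flux2_conservative g N).
- by move=> dx dy dx0 dy0; exact: (scheme_well_balanced g N dx0 dy0).
Qed.
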